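(* There are non-trivial tight proper colorings $F:{}^{\omega}\omega\to\omega$.
   Context: ${}^{\omega}\omega$ is the set of functions from $\omega$ to $\omega$. Write $x\perp y$ ($x,y$ totally different) if $x(i)\ne y(i)$ for all $i\in\omega$. $F:{}^{\omega}\omega\to\omega$ is a proper coloring if $F(x)\ne F(y)$ whenever $x\perp y$. A proper coloring $F$ is tight if for all $x\in{}^{\omega}\omega$ and $\beta\in\omega$ with $F(x)\ne\beta$ there is $y\in{}^{\omega}\omega$ with $y\perp x$ and $F(y)=\beta$. A proper coloring $F$ is trivial if there are $i\in\omega$ and a bijection $\pi:\omega\to\omega$ with $F(x)=\pi(x(i))$ for all $x\in{}^{\omega}\omega$; otherwise it is non-trivial. *)

(* Defs.v *)
From mathcomp Require Import all_boot.

Set Implicit Arguments.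
Unset Strict Implicit.
Unset Printing Implicit Defensive.

Definition baire := nat -> nat.

Definition totally_different (x y : baire) : Prop := forall i : nat, x i <> y i.

Definition proper_coloring (F : baire -> nat) : Prop :=
  forall x y : baire, totally_different x y -> F x <> F y.

(* [tight] and [trivial] do not include properness, which is to be asserted
   separately. *)
Definition tight (F : baire -> nat) : Prop :=
  forall (x : baire) (b : nat), F x <> b ->
    exists y : baire, totally_different y x /\ F y = b.

Definition trivial (F : baire -> nat) : Prop :=
  exists (i : nat) (p : nat -> nat), bijective p /\ forall x : baire, F x = p (x i).

(* Main.v *)
(** Cut the cube [nat^3] of the first three coordinates into the 2x2x2 blocks
    given by the halves of the coordinates, and colour a point by its block and
    the parity of the sum of its coordinates. Two points of a block with equal
    parity differ in an even number of coordinates, so they agree in one of the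
    three. Conversely, a point of the block with the other parity is totally
    different from its antipode in the block, and a point outside the block has
    a coordinate in which both values of the block are available, which allows
    one to adjust the parity. *)
From Stdlib Require Cantor.
Require Import Defs.
From mathcomp Require Import all_boot.

Definition block_index (x : baire) : nat :=
  Cantor.to_nat (Cantor.to_nat ((x 0)./2, (x 1)./2), (x 2)./2).

Definition block_parity (x : baire) : bool :=
  odd (x 0) (+) odd (x 1) (+) odd (x 2).

(** With the parity as lowest bit, every natural number is the colour of exactly one block and
    parity. *)
Definition block_coloring (x : baire) : nat :=
  block_parity x + (block_index x).*2.

Lemma bit_double_inj (a b : bool) (m n : nat) :
  a + m.*2 = b + n.*2 -> a = b /\ m = n.
Proof.
move=> E; split; last by rewrite -(half_bit_double m a) E half_bit_double.
by have := congr1 odd E; rewrite !oddD !odd_double !addbF !oddb.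
Qed.

Lemma block_index_eq (x y : baire) :
  block_index x = block_index y ->
  [/\ (x 0)./2 = (y 0)./2, (x 1)./2 = (y 1)./2 & (x 2)./2 = (y 2)./2].
Proof.
move=> /Cantor.to_nat_inj /pair_equal_spec [].
by move=> /Cantor.to_nat_inj /pair_equal_spec [].
Qed.

Lemma eq_odd_half (m n : nat) : odd m = odd n -> m./2 = n./2 -> m = n.
Proof. by rewrite -{3}(odd_double_half m) -{3}(odd_double_half n) => -> ->. Qed.

Lemma block_coloring_proper : proper_coloring block_coloring.
Proof.
move=> x y xy /bit_double_inj [par /block_index_eq [h0 h1 h2]].
have neq i : (x i)./2 = (y i)./2 -> odd (x i) = ~~ odd (y i).
  move=> h; have : odd (x i) <> odd (y i).
    by move=> o; apply: (xy i); apply: eq_odd_half.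
  by case: (odd (x i)); case: (odd (y i)).
move: par; rewrite /block_parity (neq _ h0) (neq _ h1) (neq _ h2).
by case: (odd (y 0)); case: (odd (y 1)); case: (odd (y 2)).
Qed.

(** The boolean premise lets [avoid_in_block] be settled by cases on bits. *)
Lemma bit_double_neq (n c : nat) (e : bool) :
  (e == odd n) ==> (c != n./2) -> e + c.*2 <> n.
Proof.
by move=> + E; rewrite -E half_bit_double oddD odd_double addbF oddb !eqxx.
Qed.

(** The [n]'s are the given point, the [c]'s the target block and [e] the target parity. *)
Lemma avoid_in_block (n0 n1 n2 c0 c1 c2 : nat) (e : bool) :
  [&& n0./2 == c0, n1./2 == c1, n2./2 == c2 &
      odd n0 (+) odd n1 (+) odd n2 == e] = false ->
  exists e0 e1 e2 : bool,
    [/\ e0 (+) e1 (+) e2 = e,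
        e0 + c0.*2 <> n0, e1 + c1.*2 <> n1 & e2 + c2.*2 <> n2].
Proof.
move=> out.
suff [e0 [e1 [e2 [<- H0 H1 H2]]]] : exists e0 e1 e2 : bool,
    [/\ e0 (+) e1 (+) e2 = e, (e0 == odd n0) ==> (c0 != n0./2),
        (e1 == odd n1) ==> (c1 != n1./2) & (e2 == odd n2) ==> (c2 != n2./2)].
  by exists e0, e1, e2; split=> //; apply: bit_double_neq.
have [par|par] := eqVneq (odd n0 (+) odd n1 (+) odd n2) e; last first.
  (* Three flips, an odd number, turn the wrong parity into [e]. *)
  exists (~~ odd n0), (~~ odd n1), (~~ odd n2); move: par.
  by case: (odd n0) (odd n1) (odd n2) e {out} => [] [] [] [].
move: out; rewrite par eqxx andbT.
rewrite (eq_sym _ c0) (eq_sym _ c1) (eq_sym _ c2) -{}par.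
(* The parity is already right: keep the bit of the last coordinate whose half differs from the
   block's, and flip the other two. *)
case: (c0 == _) (c1 == _) (c2 == _) => [] [] [] // _;
  [ exists (~~ odd n0), (~~ odd n1), (odd n2)
  | exists (~~ odd n0), (odd n1), (~~ odd n2)
  | exists (~~ odd n0), (~~ odd n1), (odd n2)
  | exists (odd n0), (~~ odd n1), (~~ odd n2)
  | exists (~~ odd n0), (~~ odd n1), (odd n2)
  | exists (~~ odd n0), (odd n1), (~~ odd n2)
  | exists (~~ odd n0), (~~ odd n1), (odd n2) ];
  by case: (odd n0) (odd n1) (odd n2) => [] [] [].
Qed.

Lemma block_coloring_tight : tight block_coloring.
Proof.
move=> x b xb.
case Eh: (Cantor.of_nat b./2) => [r c2]; case Er: (Cantor.of_nat r) => [c0 c1].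
have Eb : b = odd b + (Cantor.to_nat (Cantor.to_nat (c0, c1), c2)).*2.
  by rewrite -Er Cantor.cancel_to_of -Eh Cantor.cancel_to_of odd_double_half.
case: (@avoid_in_block (x 0) (x 1) (x 2) c0 c1 c2 (odd b)).
  apply/negP => /and4P [/eqP h0 /eqP h1 /eqP h2 /eqP par]; apply: xb.
  by rewrite /block_coloring /block_index /block_parity h0 h1 h2 par -Eb.
move=> e0 [e1 [e2 [par H0 H1 H2]]].
exists (fun i => match i with
  | 0 => e0 + c0.*2 | 1 => e1 + c1.*2 | 2 => e2 + c2.*2 | _ => (x i).+1 end).
split; first by move=> [|[|[|i]]] //; apply/eqP; rewrite eqn_leq ltnn.
rewrite /block_coloring /block_index /block_parity !half_bit_double.
by rewrite !oddD !odd_double !addbF !oddb par -Eb.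
Qed.

Lemma block_coloring_nontrivial : ~ trivial block_coloring.
Proof.
move=> [i [p [_ Fp]]].
(* These points agree at [i], but their halves are 0 and 1 elsewhere, in particular at 0 or at 1. *)
have : block_coloring (fun=> 0) = block_coloring (fun j => if j == i then 0 else 2).
  by rewrite !Fp eqxx.
move=> /bit_double_inj [_ /block_index_eq []].
by case: i {Fp} => [|i].
Qed.

Theorem corollary7p8 :
  exists F : baire -> nat, proper_coloring F /\ tight F /\ ~ trivial F.
Proof.
exists block_coloring; split; first exact: block_coloring_proper.
by split; [exact: block_coloring_tight | exact: block_coloring_nontrivial].
Qed.
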